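(* Let $p\ge 1$ and $b\ge 1$ be integers, let $K_n$ be the complete graph on $n=b+p^b$ vertices, let $\lambda$ be a $p$-periodic 1-labeling of $K_n$, and let $\mathcal{K}=(K_n,\lambda)$. Then $b\le M_p(\mathcal{K})\le n-1$. Both bounds are tight: there is a $p$-periodic 1-labeling of $K_n$ for which $M_p=b$, and there is one for which $M_p=n-1$.
   Context: A $p$-periodic 1-labeling $\lambda$ of a finite simple undirected graph $G=(V,E)$ assigns to each edge $e$ an infinite set of time-steps of the form $\{i,i+p,i+2p,\dots\}$ with $i\in\{1,\dots,p\}$ (so each edge is present exactly once in every $p$ consecutive time-steps). In the temporal graph $\mathcal{G}=(G,\lambda)$, a journey from $u$ to $v$ is a path in $G$ from $u$ to $v$ together with a choice, for each edge of the path, of a time-step in its label set so that the chosen time-steps are strictly increasing along the path. The temporal distance $\mathrm{dist}_t(u,v)$ is the smallest time-step at which a journey from $u$ reaches $v$ (with $\mathrm{dist}_t(u,u)=0$, and $\infty$ if there is no journey). A set $R\subseteq V$ is a temporal resolving set if (i) for every $v\in V$ there is a journey from some $s\in R$ to $v$ (every vertex is reached from itself), and (ii) for every two distinct $u,v\in V$ there is $s\in R$ with $\mathrm{dist}_t(s,u)\neq\mathrm{dist}_t(s,v)$. $M_p(\mathcal{G})$ denotes the minimum size of a temporal resolving set of $\mathcal{G}$. *)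

(* Defs.v *)
From mathcomp Require Import all_boot.
From mathcomp Require Import boolp.
Set Implicit Arguments.
Unset Strict Implicit.
Unset Printing Implicit Defensive.

Section TemporalGraph.

(* A finite simple undirected graph is a symmetric irreflexive relation e; the
   edge between u and v is the set [set u; v].  A labeling is a function on
   {set T}, but only its values on edges are ever used. *)
Variables (T : finType) (e : rel T).
Implicit Types (lam : {set T} -> pred nat) (u v : T) (R : {set T}).

Definition periodic_1_labeling (p : nat) lam : Prop :=
  forall u v, e u v ->
    exists2 i, 1 <= i <= p &
      forall t, lam [set u; v] t <-> exists k, t = i + k * p.

Definition edges_along u (s : seq T) : seq {set T} :=
  pairmap (fun x y => [set x; y]) u s.

(* The path has vertex sequence u :: s, and ts lists the time-steps chosen for
   its successive edges; all2 forces size ts = size s. *)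
Definition journey lam u (s : seq T) (ts : seq nat) : bool :=
  [&& path e u s, uniq (u :: s), sorted ltn ts
    & all2 lam (edges_along u s) ts].

(* The empty journey from u reaches u at time last 0 [::] = 0. *)
Definition reaches_at lam u v (t : nat) : Prop :=
  exists s ts, [/\ journey lam u s ts, last u s = v & last 0 ts = t].

(* None stands for infinity. *)
Definition temporal_dist lam u v : option nat :=
  match pselect (exists t, `[< reaches_at lam u v t >]) with
  | left ex_t => Some (ex_minn ex_t)
  | right _ => None
  end.

Definition temporal_resolving lam R : Prop :=
  (forall v, exists2 s, s \in R & exists t, reaches_at lam s v t) /\
  (forall u v, u != v ->
     exists2 s, s \in R & temporal_dist lam s u <> temporal_dist lam s v).

(* The whole vertex set is resolving as soon as no edge is present at time 0
   (temporal_resolvingT), so this is a genuine minimum. *)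
Definition temporal_metric_dim lam : nat :=
  #|[arg min_(R < [set: T] | `[< temporal_resolving lam R >]) #|R|]|.

Lemma temporal_dist_refl lam u : temporal_dist lam u u = Some 0.
Proof.
have r0 : `[< reaches_at lam u u 0 >] by apply/asboolP; exists [::], [::].
rewrite /temporal_dist; case: pselect => [ex_t|[]]; last by exists 0.
by case: ex_minnP => m _ /(_ _ r0); rewrite leqn0 => /eqP ->.
Qed.

Lemma temporal_resolvingT p lam :
  periodic_1_labeling p lam -> temporal_resolving lam [set: T].
Proof.
move=> lamP; split=> [v|u v uv].
  by exists v; rewrite ?inE //; exists 0, [::], [::].
exists u; rewrite ?inE // temporal_dist_refl /temporal_dist.
case: pselect => // ex_t; case: ex_minnP => m /asboolP[s [ts [+ + +]]] _ [] m0.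
rewrite -{}m0 => /and4P[+ _ + +] lasts.
case: s lasts => [/= uv'|x s _]; first by rewrite uv' eqxx in uv.
case: ts => [|t ts] //= /andP[eux _] lt_ts /andP[lamt _].
have [i /andP[i1 _] /(_ t)[/(_ lamt)[k tE] _]] := lamP _ _ eux.
have t0 : 0 < t by rewrite tE addn_gt0 i1.
case/lastP: ts lt_ts => [_ /= tz|ts y]; first by rewrite tz in t0.
rewrite last_rcons (path_sortedE ltn_trans) all_rcons => /andP[/andP[ty _] _] y0.
by rewrite y0 in ty.
Qed.

Lemma temporal_metric_dimP p lam : periodic_1_labeling p lam ->
  (exists2 R, temporal_resolving lam R & #|R| = temporal_metric_dim lam) /\
  (forall R, temporal_resolving lam R -> temporal_metric_dim lam <= #|R|).
Proof.
move=> /temporal_resolvingT/asboolP resT; rewrite /temporal_metric_dim.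
case: arg_minnP => // R /asboolP resR minR.
by split=> [|R' /asboolP]; [exists R | apply: minR].
Qed.

End TemporalGraph.

Definition complete_graph (n : nat) : rel 'I_n := fun u v => u != v.

(* Main.v *)
(* In a periodically labelled complete graph every distance between distinct
   vertices lies in {1, ..., p}. Hence the vertices outside a resolving set R
   have distinct distance vectors in {1, ..., p}^R, so n <= |R| + p^|R|, and the
   complement of any single vertex is resolving. If all labels are 1, distances
   only take the values 0 and 1, so at most one vertex can be left out of R.

   For the value b, the vertices are roots r_i (i < b) and one w_f for each
   f : {0, ..., b-1} -> {1, ..., p}, and the labels make dist(r_i, w_f) = f(i).
   Labelling {r_i, w_f} by f(i) does not work: r_i can reach r_j early through
   some w_g and then shortcut to w_f. Instead {r_i, w_f} has label 1 if
   f(i) = 1 and p otherwise, and for 1 < t < p the vertex w_f is linked at time t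
   to the hub w_h where h is 1 on {i | f(i) <= t} and p elsewhere; all remaining
   labels are p. At time t the hub has been reached exactly by the r_i with
   f(i) <= t, so no root arrives too early on either side of the link. *)

Require Import Defs.
From mathcomp Require Import all_boot.
From mathcomp Require Import boolp zify.
Set Implicit Arguments.
Unset Strict Implicit.
Unset Printing Implicit Defensive.

(** * Bounds on arrival times, and labelings given by a function on pairs *)

Section TemporalGraph.

Variables (T : finType) (e : rel T).
Implicit Types (lam : {set T} -> pred nat) (u v : T).

Lemma label_gt0 p lam u v t :
  periodic_1_labeling e p lam -> e u v -> lam [set u; v] t -> 0 < t.
Proof.
move=> lamP euv lamt; have [i i1p /(_ t)[/(_ lamt)[k ->] _]] := lamP _ _ euv.
lia.
Qed.

(** Induction along the journey: [P] at the current vertex is at most the current time, and since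
    time-steps increase strictly the step hypothesis applies. All lower bounds on distances come
    from such a potential. *)
Lemma reaches_at_ge p lam (P : T -> nat) u v t :
    periodic_1_labeling e p lam -> P u = 0 ->
    (forall x y k, e x y -> lam [set x; y] k -> P x < k -> P y <= k) ->
  reaches_at e lam u v t -> P v <= t.
Proof.
move=> lamP Pu step [s [ts [/and4P[us _ lt_ts lam_ts] <- <-]]].
(* Labels are positive, so the clock can start at 0, which also covers the empty journey. *)
have {lt_ts} : path ltn 0 ts.
  case: s ts us lt_ts lam_ts => [|x s] [|k ts] //= /andP[eux _] -> /andP[lamk _].
  by rewrite (label_gt0 lamP eux lamk).
have: P u <= 0 by rewrite Pu.
elim: s ts u {Pu} 0 us lam_ts => [|x s IHs] [|k ts] //= u m.
move=> /andP[eux xs] /andP[lamk lam_ts] Pum /andP[mk lt_ts].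
by apply: IHs => //; apply: (step u) => //; apply: leq_ltn_trans mk.
Qed.

Lemma temporal_dist_eq lam u v t :
    reaches_at e lam u v t -> (forall k, reaches_at e lam u v k -> t <= k) ->
  temporal_dist e lam u v = Some t.
Proof.
move=> /asboolP rt mint; rewrite /temporal_dist.
case: pselect => [ex_t|[]]; last by exists t.
case: ex_minnP => m /asboolP /mint tm /(_ _ rt) mt.
by congr Some; apply/eqP; rewrite eqn_leq mt tm.
Qed.

Lemma temporal_distE lam u v t :
  reaches_at e lam u v t ->
  exists m, [/\ temporal_dist e lam u v = Some m, reaches_at e lam u v m & m <= t].
Proof.
move=> /asboolP rt; rewrite /temporal_dist.
case: pselect => [ex_t|[]]; last by exists t.
case: ex_minnP => m /asboolP rm /(_ _ rt) mt.
by exists m.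
Qed.

Definition labeling_of p (L : T -> T -> nat) (E : {set T}) : pred nat :=
  fun t => [exists u, exists v,
    [&& E == [set u; v], L u v <= t & p %| t - L u v]].

Lemma set2_inj (u v x y : T) :
  [set u; v] = [set x; y] -> u != v -> (u = x /\ v = y) \/ (u = y /\ v = x).
Proof.
move=> E; have := set21 u v; have := set22 u v; rewrite E !inE.
by move=> /orP[]/eqP-> /orP[]/eqP->; rewrite ?eqxx; auto.
Qed.

Lemma labeling_ofP p L u v t :
    (forall x y, L x y = L y x) -> u != v ->
  reflect (exists k, t = L u v + k * p) (labeling_of p L [set u; v] t).
Proof.
move=> Lsym uv; apply: (iffP existsP) => [[x /existsP[y]]|[k ->]].
  case/and3P=> /eqP E Lt /dvdnP[k tE]; exists k; move: Lt tE.
  by case: (set2_inj E uv) => -[-> ->]; rewrite 1?[L y x]Lsym; lia.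
exists u; apply/existsP; exists v.
by rewrite eqxx leq_addr addKn dvdn_mull.
Qed.

Lemma periodic_labeling_of p L :
    irreflexive e -> (forall x y, L x y = L y x) ->
    (forall x y, 0 < L x y <= p) ->
  periodic_1_labeling e p (labeling_of p L).
Proof.
move=> eirr Lsym L1p u v euv; exists (L u v) => // t.
have uv : u != v by apply: contraTneq euv => ->; rewrite eirr.
exact: iff_sym (rwP (labeling_ofP _ _ Lsym uv)).
Qed.

End TemporalGraph.

(** * Periodically labelled complete graphs *)

Section CompleteGraph.

Variables (n p : nat) (lam : {set 'I_n} -> pred nat).
Let K := @complete_graph n.
Hypothesis lamP : periodic_1_labeling K p lam.
Implicit Types (u v : 'I_n) (R : {set 'I_n}).

Lemma reaches_at_edge u v t :
  u != v -> lam [set u; v] t -> reaches_at K lam u v t.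
Proof.
move=> uv lamt; exists [:: v], [:: t]; split=> //.
by rewrite /journey /= /K /complete_graph !inE uv lamt.
Qed.

Lemma reaches_at_edges2 u x v t k :
    [&& u != x, x != v & u != v] -> k < t ->
    lam [set u; x] k -> lam [set x; v] t -> reaches_at K lam u v t.
Proof.
move=> /and3P[ux xv uv] kt lamk lamt; exists [:: x; v], [:: k; t]; split=> //.
by rewrite /journey /= /K /complete_graph !inE (negPf ux) (negPf uv) xv kt lamk lamt.
Qed.

Lemma reaches_at_gt0 u v t : u != v -> reaches_at K lam u v t -> 0 < t.
Proof.
(* The potential is 0 at [u] and 1 elsewhere. *)
move=> uv /(@reaches_at_ge _ _ _ _ (fun x => u != x) _ _ _ lamP).
rewrite uv; apply; first by rewrite eqxx.
by move=> x y k xy /(label_gt0 lamP xy) k0 _; apply: leq_trans (leq_b1 _) k0.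
Qed.

Lemma complete_dist u v :
  u != v -> exists2 m, temporal_dist K lam u v = Some m & 0 < m <= p.
Proof.
move=> uv; have [i /andP[i1 ip] lamE] := lamP uv.
have /(reaches_at_edge uv)/temporal_distE[m [dm rm mi]] : lam [set u; v] i.
  by apply/lamE; exists 0; rewrite addn0.
by exists m => //; rewrite (reaches_at_gt0 uv rm) (leq_trans mi).
Qed.

Lemma complete_reaches u v : exists t, reaches_at K lam u v t.
Proof.
have [->|uv] := eqVneq u v; first by exists 0, [::], [::].
have [i _ lamE] := lamP uv; exists i; apply: reaches_at_edge => //.
by apply/lamE; exists 0; rewrite addn0.
Qed.

Lemma complete_dist_neq u v :
  u != v -> temporal_dist K lam u u <> temporal_dist K lam u v.
Proof.
by move=> /complete_dist[m -> /andP[m0 _]]; rewrite temporal_dist_refl => -[] m00;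
  rewrite -m00 in m0.
Qed.

(** A member of [R] is the only vertex at distance 0 from itself, so only pairs outside [R] remain
    to be separated. *)
Lemma complete_resolving R s :
    s \in R ->
    (forall u v, u \notin R -> v \notin R -> u != v ->
      exists2 x, x \in R & temporal_dist K lam x u <> temporal_dist K lam x v) ->
  temporal_resolving K lam R.
Proof.
move=> sR resR; split=> [v|u v uv].
  by exists s => //; apply: complete_reaches.
have [uR|uR] := boolP (u \in R); first by exists u => //; apply: complete_dist_neq.
have [vR|vR] := boolP (v \in R); last exact: resR.
by exists v => //; apply/nesym/complete_dist_neq; rewrite eq_sym.
Qed.

Lemma complete_metric_dim_le : 1 < n -> temporal_metric_dim K lam <= n.-1.
Proof.
move=> n1; have n0 := ltnW n1.
have [_ minR] := temporal_metric_dimP lamP.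
rewrite -[n in n.-1]card_ord -(cardsC1 (Ordinal n0)); apply: minR.
apply: (@complete_resolving _ (Ordinal n1)); first by rewrite !inE.
by move=> u v; rewrite !inE !negbK => /eqP-> /eqP->; rewrite eqxx.
Qed.

Lemma complete_resolving_card R :
  0 < p -> temporal_resolving K lam R -> n <= #|R| + p ^ #|R|.
Proof.
case: p lamP complete_dist => // q _ distP _ [_ resR].
(* Distances are shifted down by one to fit ['I_q.+1]. For [v] outside [R] they are finite and
   positive, so neither the default 0 nor the predecessor loses information. *)
pose d v := [ffun s : {s | s \in R} =>
  inord (odflt 0 (temporal_dist K lam (val s) v)).-1 : 'I_q.+1].
have d_inj : {in ~: R &, injective d}.
  move=> u v; rewrite !inE => uR vR duv; apply/eqP/negPn/negP => /resR[s sR].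
  have su : s != u by apply: contraNneq uR => <-.
  have sv : s != v by apply: contraNneq vR => <-.
  move/ffunP/(_ (exist _ s sR))/(congr1 val): duv.
  rewrite !ffunE /=.
  have [k -> kp] := distP _ _ su; have [m -> mp] := distP _ _ sv.
  rewrite /= !inordK; [|lia..].
  by move=> km; case; congr Some; lia.
have := leq_trans (eq_leq (esym (card_in_imset d_inj))) (max_card _).
rewrite card_ffun card_sig card_ord => dle.
by rewrite -[leqLHS]card_ord -(cardsC R) leq_add2l.
Qed.

End CompleteGraph.

(** If #|R| < b, then #|R| + p ^ #|R| < b + p ^ b <= n, against the counting bound. *)
Lemma metric_dim_ge n p b (lam : {set 'I_n} -> pred nat) :
    0 < p -> b + p ^ b <= n -> periodic_1_labeling (@complete_graph n) p lam ->
  b <= temporal_metric_dim (@complete_graph n) lam.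
Proof.
move=> p0 bn lamP; have [[R resR <-] _] := temporal_metric_dimP lamP.
have nR := complete_resolving_card lamP p0 resR.
rewrite leqNgt; apply/negP => Rb.
have pRb := leq_pexp2l p0 (ltnW Rb).
have := leq_trans bn (leq_trans nR (leq_add (leqnn _) pRb)).
by rewrite leq_add2r leqNgt Rb.
Qed.

(** * All labels 1: the upper bound is attained *)

Section ConstantLabeling.

Variables (n p : nat).
Let K := @complete_graph n.
Let lam : {set 'I_n} -> pred nat := labeling_of p (fun _ _ => 1).

Lemma constant_labeling_periodic : 0 < p -> periodic_1_labeling K p lam.
Proof.
by move=> p0; apply: periodic_labeling_of => // u; rewrite /K /complete_graph eqxx.
Qed.

Lemma constant_metric_dim :
  0 < p -> 1 < n -> temporal_metric_dim K lam = n.-1.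
Proof.
move=> p0 n1; have lamP := constant_labeling_periodic p0.
apply/eqP; rewrite eqn_leq (complete_metric_dim_le lamP n1) /=.
have [[R [_ resR] <-] _] := temporal_metric_dimP lamP.
have dist1 s v : s != v -> temporal_dist K lam s v = Some 1.
  move=> sv; apply: temporal_dist_eq => [|k]; last exact: (reaches_at_gt0 lamP).
  by apply: reaches_at_edge => //; apply/labeling_ofP => //; exists 0.
have: #|~: R| <= 1.
  apply/card_le1_eqP => u v; rewrite !inE => uR vR.
  apply/eqP/negPn/negP => /resR[s sR []]; rewrite !dist1 //.
    by apply: contraNneq uR => <-.
  by apply: contraNneq vR => <-.
have := cardsC R; rewrite card_ord; lia.
Qed.

End ConstantLabeling.

(** * The hub labeling: the lower bound is attained *)

Section OptimalLabeling.

Variables (q b : nat).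
Local Notation p := q.+1.
Local Notation F := {ffun 'I_b -> 'I_p}.
Local Notation U := ('I_b + F)%type.
Implicit Types (f g : F) (i : 'I_b) (x y : U).

(* The value k : 'I_p stands for the time-step k + 1. *)
Definition hub f (t : nat) : F := [ffun i => if f i <= t then ord0 else ord_max].

Definition hub_time f g : nat := \max_(i | g i == ord0) f i.

(* Since g = hub f t determines t as hub_time f g when t is a value of f, the
   edge between f and g gets the time of the link for which g serves as hub. *)
Definition hub_label f g : nat :=
  let t := hub_time f g in
  if [&& 0 < t, t < q & g == hub f t] then t.+1 else p.

(** Either of [f] and [g] may be the hub of the other; the minimum makes the label symmetric, with
    [p] standing for no link. *)
Definition opt_label x y : nat :=
  match x, y with
  | inl i, inr f | inr f, inl i => if f i == ord0 then 1 else p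
  | inr f, inr g => minn (hub_label f g) (hub_label g f)
  | inl _, inl _ => p
  end.

(** The distances from root [i] that the labeling is to realize, serving as [P] in
    [reaches_at_ge]. *)
Definition potential i x : nat :=
  match x with
  | inl j => if i == j then 0 else p
  | inr f => (f i).+1
  end.

(** As [q > 0] separates [ord_max] from [ord0], the hub is [ord0] exactly where [f] is at most
    [f i], and the maximum there is attained at [i]. *)
Lemma hub_time_hub f i : 0 < f i < q -> hub_time f (hub f (f i)) = f i.
Proof.
move=> fi; apply/eqP; rewrite eqn_leq; apply/andP; split.
  apply/bigmax_leqP => j; rewrite ffunE; case: leqP => // _ /eqP/(congr1 val) /=.
  lia.
by apply: (leq_bigmax_cond (F := fun j => f j)); rewrite ffunE leqnn.
Qed.

Lemma hub_label_bounds f g : 0 < hub_label f g <= p.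
Proof.
by rewrite /hub_label; case: ifP => [/and3P[_ tq _]|_]; [exact: leqW | exact: leqnn].
Qed.

(** Links come after time 1, when roots enter their hubs. *)
Lemma hub_label_gt1 f g : 0 < q -> 1 < hub_label f g.
Proof. by rewrite /hub_label; case: ifP => // /and3P[]. Qed.

Lemma hub_label_hub f i : 0 < f i < q -> hub_label f (hub f (f i)) = (f i).+1.
Proof.
by move=> fi; rewrite /hub_label hub_time_hub // eqxx andbT fi.
Qed.

(** A label below [p] is a genuine link with hub [g]. Root [i] is due at [g] at time 1 if it is due
    at [f] by the link time, and at time [p] otherwise. *)
Lemma hub_label_potential i f g :
    hub_label f g < p ->
  ((f i).+1 <= hub_label f g) = (g i == ord0) /\ (g i == ord0 \/ g i == ord_max).
Proof.
rewrite /hub_label; case: ifP => [/and3P[t0 tq /eqP gE] _|_]; last by rewrite ltnn.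
have -> : g i = if f i <= hub_time f g then ord0 else ord_max.
  by rewrite {1}gE ffunE.
rewrite ltnS; case: (f i <= _); rewrite eqxx; auto; split; auto.
by apply/esym/negbTE/eqP => /(congr1 val) /=; lia.
Qed.

Lemma opt_labelC x y : opt_label x y = opt_label y x.
Proof. by case: x y => [i|f] [j|g] //=; rewrite minnC. Qed.

Lemma opt_label_bounds x y : 0 < opt_label x y <= p.
Proof.
case: x y => [i|f] [j|g] //=; try by rewrite ?leqnn //; case: ifP; lia.
have := hub_label_bounds f g; have := hub_label_bounds g f; lia.
Qed.

Lemma potential_le i x : potential i x <= p.
Proof. by case: x => [j|f] /=; [case: ifP | apply: ltn_ord]. Qed.

Lemma potential_step i x y k :
  potential i x < opt_label x y + k * p ->
  potential i y <= opt_label x y + k * p.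
Proof.
have := potential_le i y.
(* Potentials never exceed [p], so only time-steps below [p] matter: label 1 at a root, or a genuine
   link. *)
case: k => [|k]; last lia.
rewrite mul0n addn0; have [|lt_p] := leqP p (opt_label x y); first lia.
move=> _; case: x y lt_p => [j|f] [l|g] //=; first by rewrite ltnn.
- case: ifP => [/eqP gj _|_]; last by rewrite ltnn.
  by case: eqP => [->|]; rewrite ?gj.
- by case: ifP => // _; rewrite ltnn.
(* Into the hub: being due at [f1] before the link forces [g1 i = ord0]. Out of it: being due at
   [g1] before the link excludes [ord_max], so [f1] is due by the link time. *)
have key f1 g1 : hub_label f1 g1 < p ->
    ((f1 i).+1 < hub_label f1 g1 -> (g1 i).+1 <= hub_label f1 g1) /\
    ((g1 i).+1 < hub_label f1 g1 -> (f1 i).+1 <= hub_label f1 g1).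
  move=> lt_p; have [fE gE] := hub_label_potential i lt_p.
  have := hub_label_bounds f1 g1; rewrite fE; split=> [/ltnW|].
    by rewrite fE => /eqP->; case/andP: (hub_label_bounds f1 g1).
  by case: gE => /eqP-> //=; lia.
have [_|_] := leqP (hub_label f g) (hub_label g f); first by case/key.
by case/key.
Qed.

Variables (n : nat) (code : 'I_n -> U) (decode : U -> 'I_n).
Hypotheses (codeK : cancel code decode) (decodeK : cancel decode code).

Let K := @complete_graph n.
Let L (u v : 'I_n) := opt_label (code u) (code v).
Let lam : {set 'I_n} -> pred nat := labeling_of p L.

Let Lsym u v : L u v = L v u. Proof. exact: opt_labelC. Qed.

Lemma opt_labeling_periodic : periodic_1_labeling K p lam.
Proof.
apply: periodic_labeling_of => [u||u v]; first by rewrite /K /complete_graph eqxx.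
- exact: Lsym.
exact: opt_label_bounds.
Qed.

Let lam_label x y : x != y -> lam [set decode x; decode y] (opt_label x y).
Proof.
move=> xy; apply/labeling_ofP; rewrite ?(can_eq decodeK) //.
by exists 0; rewrite /L !decodeK addn0.
Qed.

Lemma opt_labeling_reaches i f :
  exists2 t, reaches_at K lam (decode (inl i)) (decode (inr f)) t & t <= (f i).+1.
Proof.
have direct : reaches_at K lam (decode (inl i)) (decode (inr f))
    (opt_label (inl i) (inr f)).
  by apply: reaches_at_edge; [rewrite (can_eq decodeK) | apply: lam_label].
have [fi0|fi0] := eqVneq (f i) ord0.
  by exists 1 => //; move: direct; rewrite /= fi0 eqxx.
have [fiq|fiq] := leqP q (f i).
  by exists p => //; move: direct; rewrite /= (negPf fi0).
have fi : 0 < f i < q by rewrite fiq lt0n fi0.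
have hi : hub f (f i) i = ord0 by rewrite ffunE leqnn.
have hf : hub f (f i) != f by apply: contraNneq fi0 => hubf; rewrite -hi hubf.
(* The symmetrized label might be smaller than the intended time, hence only an upper bound here;
   the potential gives equality. *)
exists (opt_label (inr (hub f (f i))) (inr f)); last first.
  by rewrite /= -(hub_label_hub fi) geq_minr.
apply: (@reaches_at_edges2 _ _ _ (decode (inr (hub f (f i)))) _ _
  (opt_label (inl i) (inr (hub f (f i))))); rewrite ?(can_eq decodeK) //.
- by rewrite andbT.
- by rewrite /= hi eqxx leq_min !hub_label_gt1 //; lia.
- exact: lam_label.
exact: lam_label.
Qed.

Lemma opt_labeling_dist i f :
  temporal_dist K lam (decode (inl i)) (decode (inr f)) = Some (f i).+1.
Proof.
have lower k : reaches_at K lam (decode (inl i)) (decode (inr f)) k -> f i < k.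
  move=> /(@reaches_at_ge _ _ _ _ (fun u => potential i (code u)) _ _ _
    opt_labeling_periodic).
  rewrite !decodeK /=; apply; first by rewrite eqxx.
  move=> u v t uv /(labeling_ofP _ _ Lsym uv)[m ->].
  exact: potential_step.
have [t rt tf] := opt_labeling_reaches i f.
apply: temporal_dist_eq => //.
suff <- : t = (f i).+1 by [].
by apply/eqP; rewrite eqn_leq tf lower.
Qed.

Lemma opt_metric_dim_le : 0 < b -> temporal_metric_dim K lam <= b.
Proof.
move=> b0; have [_ minR] := temporal_metric_dimP opt_labeling_periodic.
pose R := [set decode (inl i) | i : 'I_b].
have <- : #|R| = b.
  by rewrite card_imset ?card_ord // => i j /(can_inj decodeK)[].
apply: minR.
apply: (complete_resolving opt_labeling_periodic (s := decode (inl (Ordinal b0)))).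
  exact: imset_f.
have notR u : u \notin R -> exists f, u = decode (inr f).
  rewrite -[u]codeK; case: (code u) => [i|f]; last by exists f.
  by rewrite imset_f.
move=> u v /notR[f ->] /notR[g ->]; rewrite (can_eq decodeK) => fg.
have [i fgi] : exists i, f i != g i.
  by apply/existsP; apply: contraNT fg; rewrite negb_exists => /forallP E;
    apply/eqP; congr inr; apply/ffunP => i; apply/eqP/negPn.
exists (decode (inl i)); first exact: imset_f.
by rewrite !opt_labeling_dist => -[] /val_inj/eqP; rewrite (negPf fgi).
Qed.

End OptimalLabeling.

Theorem theorem13 (p b : nat) (hp : 1 <= p) (hb : 1 <= b) :
  let n := b + p ^ b in
  let K := @complete_graph n in
  [/\ forall lam : {set 'I_n} -> pred nat,
        periodic_1_labeling K p lam ->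
        b <= temporal_metric_dim K lam <= n - 1,
      exists2 lam : {set 'I_n} -> pred nat,
        periodic_1_labeling K p lam & temporal_metric_dim K lam = b
    & exists2 lam : {set 'I_n} -> pred nat,
        periodic_1_labeling K p lam & temporal_metric_dim K lam = n - 1].
Proof.
move=> n K; have n1 : 1 < n by apply: (leq_add hb); rewrite expn_gt0 hp.
split=> [lam lamP||].
- by rewrite (metric_dim_ge hp _ lamP) // subn1 (complete_metric_dim_le lamP n1).
- case: p hp @n @K n1 => // q hp n K n1.
  (* Vertices are numbered by enumerating roots and functions, [b + p ^ b] in all. *)
  have cardU : #|{: 'I_b + {ffun 'I_b -> 'I_q.+1}}| = n.
    by rewrite card_sum card_ffun !card_ord.
  pose decode x : 'I_n := cast_ord cardU (enum_rank x).
  pose code (u : 'I_n) := enum_val (cast_ord (esym cardU) u).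
  have codeK : cancel code decode.
    by move=> u; rewrite /decode enum_valK cast_ordKV.
  have decodeK : cancel decode code.
    by move=> x; rewrite /code cast_ordK enum_rankK.
  have lamP := opt_labeling_periodic code.
  eexists; first exact: lamP.
  apply/eqP; rewrite eqn_leq (opt_metric_dim_le codeK decodeK hb).
  exact: metric_dim_ge lamP.
exists (labeling_of p (fun _ _ => 1)); first exact: constant_labeling_periodic.
by rewrite subn1 constant_metric_dim.
Qed.
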